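(* Let $k$ be a commutative ring. Suppose $B$ is an Azumaya $k$-algebra and $A$ is a $k$-algebra which is finitely generated projective as a $k$-module and which contains $B$ as a (unital) subalgebra. Then $A\supseteq B$ is a depth two extension.
   Context: Algebras are unital and associative. An algebra extension $A\supseteq B$ is left depth two if for some positive integer $n$ the natural $B$-$A$-bimodule $A\otimes_B A$ is isomorphic to a direct summand of $A^n$ as $B$-$A$-bimodules. It is right depth two if for some positive integer $n$ the natural $A$-$B$-bimodule $A\otimes_B A$ is isomorphic to a direct summand of $A^n$ as $A$-$B$-bimodules. It is depth two if it is both left and right depth two. An Azumaya $k$-algebra is a separable $k$-algebra with center $k$. *)

(* Defs.v *)
From HB Require Import structures.
From mathcomp Require Import all_boot all_order all_algebra.
From mathcomp Require Import generic_quotient ring_quotient.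
From mathcomp Require Import boolp freeg.

Set Implicit Arguments.
Unset Strict Implicit.
Unset Printing Implicit Defensive.

Import GRing.Theory.
Local Open Scope ring_scope.
Local Open Scope quotient_scope.

Local Obligation Tactic := idtac.

Record bimodule (R S : pzRingType) := Bimodule {
  bimod_sort :> zmodType;
  lact : R -> bimod_sort -> bimod_sort;
  ract : bimod_sort -> S -> bimod_sort;
  lactDr : forall r x y, lact r (x + y) = lact r x + lact r y;
  lactDl : forall r r' x, lact (r + r') x = lact r x + lact r' x;
  lactA : forall r r' x, lact (r * r') x = lact r (lact r' x);
  lact1 : forall x, lact 1 x = x;
  ractDl : forall x y s, ract (x + y) s = ract x s + ract y s;
  ractDr : forall x s s', ract x (s + s') = ract x s + ract x s';
  ractA : forall x s s', ract x (s * s') = ract (ract x s) s';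
  ract1 : forall x, ract x 1 = x;
  lract : forall r x s, ract (lact r x) s = lact r (ract x s)
}.

Definition bimod_hom (R S : pzRingType) (M N : bimodule R S) (f : M -> N) :=
  [/\ forall x y, f (x + y) = f x + f y,
      forall r x, f (lact r x) = lact r (f x) &
      forall x s, f (ract x s) = ract (f x) s].

Definition bimod_isom (R S : pzRingType) (M N : bimodule R S) :=
  exists2 f : M -> N, bimod_hom f & bijective f.

Section DirectSums.
Variables (R S : pzRingType).

Program Definition bimod_sum (M N : bimodule R S) : bimodule R S :=
  @Bimodule R S (M * N)%type
    (fun r x => (lact r x.1, lact r x.2)) (fun x s => (ract x.1 s, ract x.2 s))
    _ _ _ _ _ _ _ _ _.
Next Obligation. by move=> M N r x y; apply: injective_projections; apply: lactDr. Qed.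
Next Obligation. by move=> M N r r' x; apply: injective_projections; apply: lactDl. Qed.
Next Obligation. by move=> M N r r' x; apply: injective_projections; apply: lactA. Qed.
Next Obligation. by move=> M N [x y]; apply: injective_projections; apply: lact1. Qed.
Next Obligation. by move=> M N x y s; apply: injective_projections; apply: ractDl. Qed.
Next Obligation. by move=> M N x s s'; apply: injective_projections; apply: ractDr. Qed.
Next Obligation. by move=> M N x s s'; apply: injective_projections; apply: ractA. Qed.
Next Obligation. by move=> M N [x y]; apply: injective_projections; apply: ract1. Qed.
Next Obligation. by move=> M N r x s; apply: injective_projections; apply: lract. Qed.

Program Definition bimod_pow (M : bimodule R S) (n : nat) : bimodule R S :=
  @Bimodule R S {ffun 'I_n -> M}
    (fun r x => [ffun i => lact r (x i)]) (fun x s => [ffun i => ract (x i) s])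
    _ _ _ _ _ _ _ _ _.
Next Obligation. by move=> M n r x y; apply/ffunP=> i; rewrite !ffunE lactDr. Qed.
Next Obligation. by move=> M n r r' x; apply/ffunP=> i; rewrite !ffunE lactDl. Qed.
Next Obligation. by move=> M n r r' x; apply/ffunP=> i; rewrite !ffunE lactA. Qed.
Next Obligation. by move=> M n x; apply/ffunP=> i; rewrite !ffunE lact1. Qed.
Next Obligation. by move=> M n x y s; apply/ffunP=> i; rewrite !ffunE ractDl. Qed.
Next Obligation. by move=> M n x s s'; apply/ffunP=> i; rewrite !ffunE ractDr. Qed.
Next Obligation. by move=> M n x s s'; apply/ffunP=> i; rewrite !ffunE ractA. Qed.
Next Obligation. by move=> M n x; apply/ffunP=> i; rewrite !ffunE ract1. Qed.
Next Obligation. by move=> M n r x s; apply/ffunP=> i; rewrite !ffunE lract. Qed.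

Definition isom_to_summand (M N : bimodule R S) :=
  exists Q : bimodule R S, bimod_isom (bimod_sum M Q) N.

End DirectSums.

Program Definition ring_bimod (R S A : pzRingType)
    (f : {rmorphism R -> A}) (g : {rmorphism S -> A}) : bimodule R S :=
  @Bimodule R S A (fun r x => f r * x) (fun x s => x * g s) _ _ _ _ _ _ _ _ _.
Next Obligation. by move=> R S A f g r x y; rewrite /= mulrDr. Qed.
Next Obligation. by move=> R S A f g r r' x; rewrite /= rmorphD mulrDl. Qed.
Next Obligation. by move=> R S A f g r r' x; rewrite /= rmorphM mulrA. Qed.
Next Obligation. by move=> R S A f g x; rewrite /= rmorph1 mul1r. Qed.
Next Obligation. by move=> R S A f g x y s; rewrite /= mulrDl. Qed.
Next Obligation. by move=> R S A f g x s s'; rewrite /= rmorphD mulrDr. Qed.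
Next Obligation. by move=> R S A f g x s s'; rewrite /= rmorphM mulrA. Qed.
Next Obligation. by move=> R S A f g x; rewrite /= rmorph1 mulr1. Qed.
Next Obligation. by move=> R S A f g r x s; rewrite /= mulrA. Qed.

Section FreeLift.
Variables (K : choiceType) (V : zmodType).

(* Additive extension of f : K -> V to the free abelian group on K. *)
Definition free_lift (f : K -> V) (D : {freeg K / int}) : V :=
  fglift (f : K -> zmodule V) D.

Lemma free_liftB f : {morph free_lift f : x y / x - y}.
Proof. exact: (@lift_is_additive _ _ _ (f : K -> zmodule V)). Qed.

Lemma free_lift0 f : free_lift f 0 = 0.
Proof. by have := free_liftB f 0 0; rewrite !subrr. Qed.

Lemma free_liftN f : {morph free_lift f : x / - x}.
Proof. by move=> x; rewrite -(sub0r x) free_liftB free_lift0 sub0r. Qed.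

Lemma free_liftD f : {morph free_lift f : x y / x + y}.
Proof. by move=> x y; rewrite -{1}(opprK y) free_liftB free_liftN opprK. Qed.

Lemma free_liftU f x : free_lift f << x >> = f x.
Proof. by rewrite /free_lift liftU scale1r. Qed.

Lemma free_ind (P : {freeg K / int} -> Prop) :
  P 0 -> (forall x y, P x -> P y -> P (x - y)) -> (forall x, P << x >>) ->
  forall D, P D.
Proof.
move=> P0 PB PU; have PN x : P x -> P (- x) by rewrite -sub0r; exact: PB.
have PD x y : P x -> P y -> P (x + y).
  by move=> Px Py; rewrite -(opprK y); apply/PB/PN.
move=> D; rewrite -[D]freeg_sumE; elim/big_ind: _ => // x _.
rewrite -[coeff x D]intz -freegU_mulz.
have PMn n : P (<< x >> *+ n).
  by elim: n => [|n IH]; rewrite ?mulr0n // mulrS; apply: PD.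
by case: (coeff x D) => n; rewrite ?NegzE ?mulrNz -pmulrn; [|apply: PN].
Qed.

Lemma free_lift_eq (f g : {freeg K / int} -> V) :
  {morph f : x y / x - y} -> {morph g : x y / x - y} ->
  (forall x, f << x >> = g << x >>) -> f =1 g.
Proof.
move=> fB gB fg; apply: free_ind => // [|x y fx fy]; last by rewrite fB gB fx fy.
by have := fB 0 0; have := gB 0 0; rewrite !subrr => -> ->.
Qed.

End FreeLift.

Section Tensor.
Variables (R S T : pzRingType) (M : bimodule R S) (N : bimodule S T).

Local Notation F := {freeg (M * N)%type / int}.

Inductive tensor_rel : F -> Prop :=
| tensor_rel0 : tensor_rel 0
| tensor_relB x y : tensor_rel x -> tensor_rel y -> tensor_rel (x - y)
| tensor_relDl m m' n : tensor_rel (<< (m + m', n) >> - << (m, n) >> - << (m', n) >>)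
| tensor_relDr m n n' : tensor_rel (<< (m, n + n') >> - << (m, n) >> - << (m, n') >>)
| tensor_relM m s n : tensor_rel (<< (ract m s, n) >> - << (m, lact s n) >>).

Definition tensor_relb : F -> bool := fun x => `[< tensor_rel x >].

Lemma tensor_relb_closed : zmod_closed tensor_relb.
Proof.
split=> [|x y /asboolP xP /asboolP yP]; apply/asboolP; first exact: tensor_rel0.
exact: tensor_relB.
Qed.

Definition tensor_ker : zmodClosed F :=
  HB.pack tensor_relb (GRing.isZmodClosed.Build F tensor_relb tensor_relb_closed).

Definition tensor_sort : zmodType := Quotient.quot tensor_ker.

Definition tmk (x : F) : tensor_sort := \pi_tensor_sort x.
Definition tens (m : M) (n : N) : tensor_sort := tmk << (m, n) >>.

Lemma tmkB : {morph tmk : x y / x - y}.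
Proof. exact: (raddfB (\pi_(Quotient.quot tensor_ker))). Qed.

Lemma tmk_eq x y : (tmk x = tmk y) <-> tensor_rel (x - y).
Proof.
split=> [xy | xy].
  by apply/asboolP; rewrite -[asbool _]/(x - y \in tensor_ker) Quotient.idealrBE; apply/eqP.
by apply/eqP; rewrite -[_ == _]Quotient.idealrBE; apply/asboolP.
Qed.

Lemma tmk_repr t : tmk (repr t) = t. Proof. exact: reprK. Qed.

Lemma tensor_ind (P : tensor_sort -> Prop) :
  P 0 -> (forall x y, P x -> P y -> P (x - y)) -> (forall m n, P (tens m n)) ->
  forall t, P t.
Proof.
move=> P0 PB PU t; rewrite -(tmk_repr t); move: (repr t) => {t}.
apply: free_ind => [|x y Px Py|[m n]]; last exact: PU.
  by have := tmkB 0 0; rewrite !subrr => ->.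
by rewrite tmkB; apply: PB.
Qed.

Lemma tensDl m m' n : tens (m + m') n = tens m n + tens m' n.
Proof.
apply/eqP; rewrite -subr_eq0 opprD addrA -!tmkB; apply/eqP.
rewrite -[RHS](subrr (tmk 0)) -tmkB; apply/tmk_eq.
by rewrite !subr0; apply: tensor_relDl.
Qed.

Lemma tensDr m n n' : tens m (n + n') = tens m n + tens m n'.
Proof.
apply/eqP; rewrite -subr_eq0 opprD addrA -!tmkB; apply/eqP.
rewrite -[RHS](subrr (tmk 0)) -tmkB; apply/tmk_eq.
by rewrite !subr0; apply: tensor_relDr.
Qed.

Lemma tensM m s n : tens (ract m s) n = tens m (lact s n).
Proof. by apply/tmk_eq; apply: tensor_relM. Qed.

Section Lift.
Variables (V : zmodType) (f : M -> N -> V).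

(* Meaningful for balanced f; see tensor_liftE. *)
Definition tensor_lift (t : tensor_sort) : V :=
  free_lift (fun p : (M * N)%type => f p.1 p.2) (repr t).

Definition balanced :=
  [/\ forall m m' n, f (m + m') n = f m n + f m' n,
      forall m n n', f m (n + n') = f m n + f m n' &
      forall m s n, f (ract m s) n = f m (lact s n)].

Hypothesis f_bal : balanced.

Lemma tensor_lift_mk x :
  tensor_lift (tmk x) = free_lift (fun p : (M * N)%type => f p.1 p.2) x.
Proof.
apply/eqP; rewrite -subr_eq0 -free_liftB; apply/eqP.
have: tensor_rel (repr (tmk x) - x) by apply/tmk_eq; rewrite tmk_repr.
have [fDl fDr fM] := f_bal.
elim=> [|y z _ IHy _ IHz|m m' n|m n n'|m s n].
- exact: free_lift0.
- by rewrite free_liftB IHy IHz subrr.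
- by rewrite !free_liftB !free_liftU /= fDl addrAC addrK subrr.
- by rewrite !free_liftB !free_liftU /= fDr addrAC addrK subrr.
- by rewrite free_liftB !free_liftU /= fM subrr.
Qed.

Lemma tensor_liftE m n : tensor_lift (tens m n) = f m n.
Proof. by rewrite tensor_lift_mk free_liftU. Qed.

Lemma tensor_liftB : {morph tensor_lift : x y / x - y}.
Proof.
move=> x y; rewrite -(tmk_repr x) -(tmk_repr y) -tmkB.
by rewrite !tensor_lift_mk free_liftB.
Qed.

Lemma tensor_lift0 : tensor_lift 0 = 0.
Proof. by have := tensor_liftB 0 0; rewrite !subrr. Qed.

Lemma tensor_liftN : {morph tensor_lift : x / - x}.
Proof. by move=> x; rewrite -(sub0r x) tensor_liftB tensor_lift0 sub0r. Qed.

Lemma tensor_liftD : {morph tensor_lift : x y / x + y}.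
Proof. by move=> x y; rewrite -{1}(opprK y) tensor_liftB tensor_liftN opprK. Qed.

End Lift.

Definition tensor_lact (r : R) : tensor_sort -> tensor_sort :=
  tensor_lift (fun m n => tens (lact r m) n).

Definition tensor_ract (t : tensor_sort) (s : T) : tensor_sort :=
  tensor_lift (fun m n => tens m (ract n s)) t.

Lemma tensor_lact_bal r : balanced (fun m n => tens (lact r m) n).
Proof.
split=> [m m' n|m n n'|m s n]; first by rewrite lactDr tensDl.
  by rewrite tensDr.
by rewrite -lract tensM.
Qed.

Lemma tensor_ract_bal s : balanced (fun m n => tens m (ract n s)).
Proof.
split=> [m m' n|m n n'|m u n]; first by rewrite tensDl.
  by rewrite ractDl tensDr.
by rewrite lract tensM.
Qed.

Lemma tensor_lactE r m n : tensor_lact r (tens m n) = tens (lact r m) n.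
Proof. exact: tensor_liftE (tensor_lact_bal r) m n. Qed.

Lemma tensor_ractE m n s : tensor_ract (tens m n) s = tens m (ract n s).
Proof. exact: tensor_liftE (tensor_ract_bal s) m n. Qed.

Lemma tensor_lactB r : {morph tensor_lact r : x y / x - y}.
Proof. exact: tensor_liftB (tensor_lact_bal r). Qed.

Lemma tensor_ractB s : {morph tensor_ract^~ s : x y / x - y}.
Proof. exact: tensor_liftB (tensor_ract_bal s). Qed.

Lemma tensor_lact0 r : tensor_lact r 0 = 0.
Proof. exact: tensor_lift0 (tensor_lact_bal r). Qed.

Lemma tensor_ract0 s : tensor_ract 0 s = 0.
Proof. exact: tensor_lift0 (tensor_ract_bal s). Qed.

Program Definition tensor : bimodule R T :=
  @Bimodule R T tensor_sort tensor_lact tensor_ract _ _ _ _ _ _ _ _ _.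
Next Obligation. by move=> r x y; apply: tensor_liftD (tensor_lact_bal r) x y. Qed.
Next Obligation.
move=> r r'; apply: tensor_ind => [|x y Hx Hy|m n].
- by rewrite !tensor_lact0 addr0.
- by rewrite !tensor_lactB Hx Hy opprD addrACA.
- by rewrite !tensor_lactE lactDl tensDl.
Qed.
Next Obligation.
move=> r r'; apply: tensor_ind => [|x y Hx Hy|m n].
- by rewrite !tensor_lact0.
- by rewrite !tensor_lactB Hx Hy.
- by rewrite !tensor_lactE lactA.
Qed.
Next Obligation.
apply: tensor_ind => [|x y Hx Hy|m n].
- by rewrite tensor_lact0.
- by rewrite tensor_lactB Hx Hy.
- by rewrite tensor_lactE lact1.
Qed.
Next Obligation. by move=> x y s; apply: tensor_liftD (tensor_ract_bal s) x y. Qed.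
Next Obligation.
move=> x s s'; move: x; apply: tensor_ind => [|x y Hx Hy|m n].
- by rewrite !tensor_ract0 addr0.
- by rewrite !tensor_ractB Hx Hy opprD addrACA.
- by rewrite !tensor_ractE ractDr tensDr.
Qed.
Next Obligation.
move=> x s s'; move: x; apply: tensor_ind => [|x y Hx Hy|m n].
- by rewrite !tensor_ract0.
- by rewrite !tensor_ractB Hx Hy.
- by rewrite !tensor_ractE ractA.
Qed.
Next Obligation.
apply: tensor_ind => [|x y Hx Hy|m n].
- by rewrite tensor_ract0.
- by rewrite tensor_ractB Hx Hy.
- by rewrite tensor_ractE ract1.
Qed.
Next Obligation.
move=> r x s; move: x; apply: tensor_ind => [|x y Hx Hy|m n].
- by rewrite tensor_ract0 tensor_lact0 tensor_ract0.
- by rewrite tensor_lactB !tensor_ractB tensor_lactB Hx Hy.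
- by rewrite !(tensor_lactE, tensor_ractE).
Qed.

End Tensor.

Section Extensions.
Variables (B A : pzRingType) (i : {rmorphism B -> A}).

(* The three natural bimodule structures on the tensor square of A over B. *)
Definition tensor_sq_BA : bimodule B A :=
  tensor (ring_bimod i i) (ring_bimod i idfun).
Definition tensor_sq_AB : bimodule A B :=
  tensor (ring_bimod idfun i) (ring_bimod i i).
Definition tensor_sq_AA : bimodule A A :=
  tensor (ring_bimod idfun i) (ring_bimod i idfun).

Definition left_depth_two := exists2 n : nat, (0 < n)%N &
  isom_to_summand tensor_sq_BA (bimod_pow (ring_bimod i idfun) n).

Definition right_depth_two := exists2 n : nat, (0 < n)%N &
  isom_to_summand tensor_sq_AB (bimod_pow (ring_bimod idfun i) n).

Definition depth_two := left_depth_two /\ right_depth_two.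

Definition mul_map : tensor_sq_AA -> ring_bimod (@idfun A) (@idfun A) :=
  @tensor_lift A B A (ring_bimod idfun i) (ring_bimod i idfun) A
    (fun x y : A => x * y).

Lemma mul_mapE (x : ring_bimod (@idfun A) i) (y : ring_bimod i (@idfun A)) :
  mul_map (tens x y) = (x : A) * (y : A).
Proof.
apply: tensor_liftE; split=> [m m' n|m n n'|m s n] /=.
- exact: mulrDl.
- exact: mulrDr.
- by rewrite mulrA.
Qed.

Definition separable_ext :=
  exists2 s : ring_bimod (@idfun A) (@idfun A) -> tensor_sq_AA,
    bimod_hom s & forall x, mul_map (s x) = x.

End Extensions.

Definition separable_algebra (k : comPzRingType) (B : algType k) :=
  separable_ext (GRing.in_alg B).

Definition has_center (k : comPzRingType) (B : algType k) :=
  injective (GRing.in_alg B) /\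
  forall b : B, (forall x : B, b * x = x * b) <-> exists c : k, b = c%:A.

Definition Azumaya (k : comPzRingType) (B : algType k) :=
  separable_algebra B /\ has_center B.

Definition finitely_generated (k : pzRingType) (V : lmodType k) :=
  exists n (v : 'I_n -> V), forall x, exists c : 'I_n -> k,
    x = \sum_(i < n) c i *: v i.

Definition projective (k : pzRingType) (V : lmodType k) :=
  forall (M N : lmodType k) (p : {linear M -> N}) (f : {linear V -> N}),
    (forall y, exists x, p x = y) ->
    exists g : {linear V -> M}, forall x, p (g x) = f x.

(* Main.v *)
Require Import Defs.
From HB Require Import structures.
From mathcomp Require Import all_boot all_order all_algebra boolp.

Set Implicit Arguments.
Unset Strict Implicit.
Unset Printing Implicit Defensive.

Import GRing.Theory.
Local Open Scope ring_scope.

(** The extension is depth two because, as a bimodule over B, the algebra A is a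
direct summand of a power of B; tensoring such a splitting over B with A, on the
right or on the left, makes the tensor square of A a direct summand of a power of
A as a B-A- or an A-B-bimodule.  The splitting consists of elements c_l of A
commuting with B and B-bimodule maps b_l from A to B such that x is the sum of
the b_l(x) c_l.

Let e = sum u_p (x) v_p be a separability idempotent of B.  Averaging,
E(x) = sum u_p x v_p, retracts A onto the centraliser C of B.  On B itself it
takes values in the centre, so E(b) = eps(b) 1 for a k-linear form eps with
eps(1) = 1.  Everything rests on an expansion, with finitely many w, y, z in B,

    x = sum w E(y x z)    for all x in A,                       (1)

which exhibits A as the tensor product of B and C.  By restriction along E, a
finite dual basis (v_l, f_l) of A over k yields the dual basis E(v_l) of C, and
c_l = E(v_l), b_l(x) = sum f_l(E(y x z)) w are as required
([azumaya_centrally_projective]): on a product of b in B and c in C, the map b_l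
takes the value f_l(c) b, and such products span A.

For (1) it is enough to write 1 in k as a sum of elements of the form

    sum_p eps(a u_p b) eps(b' v_p a').                          (2)

Indeed, multiply x on the left by eps(a u_p b), on the right by eps(b' v_p a'),
expand both values of eps as averages and recognise the sum over p as an average
as well ([azumaya_expansion]).

The elements of the form (2) generate an ideal T of k, and 1 lies in T: modulo a
maximal ideal containing T, the forms eps(a _ b) separate the points of B modulo
the two-sided ideal that they all kill, so that the vanishing of all elements (2)
makes e vanish there, whereas sum u_p v_p = 1 and eps(1) = 1.
[vanishing_tensor_value] carries this out by Gaussian elimination on the length of
a tensor, without dividing: it works modulo radical ideals and passes from I to
the colon ideal (I : c) where one would otherwise invert a nonzero scalar. *)

(** * Radical ideals of the base ring *)

Section Ideals.
Variable k : comPzRingType.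
Implicit Types (I : k -> Prop) (c x y : k).

Definition ideal I :=
  [/\ I 0, forall x y, I x -> I y -> I (x + y) & forall r x, I x -> I (r * x)].

Definition radical_ideal I := ideal I /\ forall x, I (x * x) -> I x.

Definition colon I c x := I (x * c).

Definition radical I x := exists n, I (x ^+ n).

Lemma radical_ideal_colon I c : radical_ideal I -> radical_ideal (colon I c).
Proof.
case=> [[I0 ID IM] Irad]; split; first split; rewrite /colon.
- by rewrite mul0r.
- by move=> x y Ix Iy; rewrite mulrDl; apply: ID.
- by move=> r x Ix; rewrite -mulrA; apply: IM.
- by move=> x Ix; apply: Irad; rewrite mulrACA mulrA mulrC; apply: IM.
Qed.

Lemma ideal_sum I (T : Type) (s : seq T) (P : pred T) (F : T -> k) :
  ideal I -> (forall j, P j -> I (F j)) -> I (\sum_(j <- s | P j) F j).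
Proof. by move=> [I0 ID _] IF; apply: (big_ind I). Qed.

Lemma radical_ideal_radical I : ideal I -> radical_ideal (radical I).
Proof.
move=> Iid; have [I0 ID IM] := Iid; split; [split|].
- by exists 1%N; rewrite expr1.
- move=> x y [m Im] [n In]; exists (m + n)%N.
  rewrite exprDn; apply: ideal_sum => // j _.
  rewrite -mulr_natl; apply: (IM); have [le_nj|lt_jn] := leqP n j.
    by rewrite -[in y ^+ j](subnK le_nj) exprD mulrA; apply: (IM).
  by rewrite -addnBA ?(ltnW lt_jn) // exprD -mulrA mulrC; apply: (IM).
- move=> r x [n In]; exists n; rewrite exprMn; exact: IM.
- by move=> x [n In]; exists (n + n)%N; rewrite exprD -exprMn.
Qed.

End Ideals.

(** * Eliminating the terms of a tensor *)

Section Descent.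
Variables (k : comPzRingType) (B : algType k) (eps : {scalar B}).
Hypothesis eps1 : eps 1 = 1.
Implicit Types (I : k -> Prop) (s : seq (B * B)).

(** The largest two-sided ideal of B on which eps vanishes modulo I. *)
Definition kills I (y : B) := forall a b, I (eps (a * y * b)).

Lemma killsD I : ideal I -> forall x y, kills I x -> kills I y -> kills I (x + y).
Proof.
by move=> [_ ID _] x y Nx Ny a b; rewrite mulrDr mulrDl linearD; apply: ID;
  [apply: Nx|apply: Ny].
Qed.

Lemma killsZ I : ideal I -> forall c x, kills I x -> kills I (c *: x).
Proof.
by move=> [_ _ IM] c x Nx a b; rewrite -scalerAr -scalerAl linearZ; apply: IM.
Qed.

Lemma killsB I : ideal I -> forall x y, kills I x -> kills I y -> kills I (x - y).
Proof. by move=> iI x y Nx Ny; rewrite -scaleN1r; apply: killsD => //; apply: killsZ. Qed.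

Lemma kills_mulr I x y : kills I x -> kills I (x * y).
Proof. by move=> Nx a b; rewrite mulrA -mulrA; apply: Nx. Qed.

Lemma kills_mull I x y : kills I x -> kills I (y * x).
Proof. by move=> Nx a b; rewrite mulrA; apply: Nx. Qed.

Lemma kills_scale I c x : ideal I -> I c -> kills I (c *: x).
Proof.
move=> [_ _ IM] Ic a b; rewrite -scalerAr -scalerAl linearZ /= mulrC; exact: IM.
Qed.

Lemma kills_colon I c x : kills (colon I c) x <-> kills I (c *: x).
Proof.
by split=> Nx a b; have := Nx a b;
  rewrite /colon -scalerAr -scalerAl linearZ /= mulrC.
Qed.

(** For a maximal ideal I, the forms eps(a _ b) separate the points of the k/I-space
B / [kills I]; if they all annihilate the tensor s when applied to its first leg,
then s vanishes there, and so does the product c of its legs; as eps(1) = 1, this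
puts c in I.  For a radical ideal, the proof shortens s = u (x) v + s'.  If some
t = eps(a0 u b0) is invertible modulo I, the hypothesis for (a0, b0) expresses v
through the second legs of s', so that t s is represented by a tensor of length
size s'; in general this shows that t c belongs to I.  Hence every eps(a u b) lies
in (I : c), which means that u is killed modulo that ideal, where s can be
replaced by s': therefore c lies in (I : c), that is c ^ 2 lies in I. *)
Lemma vanishing_tensor_value s I (c : k) : radical_ideal I ->
  (forall a b, kills I (\sum_(p <- s) eps (a * p.1 * b) *: p.2)) ->
  kills I (\sum_(p <- s) p.1 * p.2 - c%:A) -> I c.
Proof.
have [n] := ubnP (size s); elim: n s I c => // n IHn [|[u v] s] I c /= lt_sn radI.
  move=> _; rewrite big_nil sub0r => /(_ (-1) 1).
  by rewrite mulr1 mulrNN mul1r linearZ /= eps1 mulr1.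
have [iI Irad] := radI; have [I0 ID IM] := iI.
move=> Nphi N1.
have Ntc a0 b0 : I (eps (a0 * u * b0) * c).
  set t := eps _.
  (* Substituting t v = - sum eps(a0 p b0) q over the terms p (x) q of s'
     turns t p into w p. *)
  pose w p : B := t *: p - eps (a0 * p * b0) *: u.
  apply: (IHn [seq (w p.1, p.2) | p <- s]) => //; first by rewrite size_map.
    move=> a b; rewrite big_map /=.
    have -> : \sum_(p <- s) eps (a * w p.1 * b) *: p.2 =
      t *: (\sum_(p <- (u, v) :: s) eps (a * p.1 * b) *: p.2)
      - eps (a * u * b) *: (\sum_(p <- (u, v) :: s) eps (a0 * p.1 * b0) *: p.2).
      rewrite !big_cons /= !scalerDr !scalerA opprD addrACA [t * _]mulrC subrr add0r.
      rewrite !scaler_sumr -sumrB; apply: eq_bigr => p _.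
      rewrite mulrBr mulrBl -!scalerAr -!scalerAl linearB !linearZ /= scalerBl !scalerA.
      by rewrite scalerN mulrC; congr (_ - _ *: _); rewrite mulrC.
    by apply: killsB => //; apply: killsZ.
  have -> : \sum_(p <- [seq (w p.1, p.2) | p <- s]) p.1 * p.2 - (t * c)%:A =
    t *: (\sum_(p <- (u, v) :: s) p.1 * p.2 - c%:A)
    - u * (\sum_(p <- (u, v) :: s) eps (a0 * p.1 * b0) *: p.2).
    rewrite big_map !big_cons /= mulrDr scalerBr scalerDr -/t -scalerAr.
    rewrite -[_ + _ - t *: c%:A]addrA opprD addrACA subrr add0r addrAC.
    congr (_ - _).
      rewrite scaler_sumr mulr_sumr -sumrB; apply: eq_bigr => p _ /=.
      by rewrite mulrBl -!scalerAl -scalerAr.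
    by rewrite scalerA.
  by apply: killsB => //; [apply: killsZ | apply: kills_mull].
have radIc := radical_ideal_colon c radI; have [iIc _] := radIc.
have Nu : kills (colon I c) u by move=> a b; apply: Ntc.
apply: Irad; apply: (IHn s (colon I c)) => //.
  move=> a b.
  have := killsB iIc ((kills_colon _ _ _).2 (killsZ iI c (Nphi a b)))
            (kills_scale v iIc (Ntc a b)).
  by rewrite big_cons /= addrAC subrr add0r.
have := killsB iIc ((kills_colon _ _ _).2 (killsZ iI c N1)) (kills_mulr v Nu).
by rewrite big_cons /= addrAC [_ + _ - u * v]addrAC subrr add0r.
Qed.
End Descent.

(** * The elements (2) generate the unit ideal *)

Section TraceIdeal.
Variables (k : comPzRingType) (B : algType k) (eps : {scalar B}).
Variable e : seq (B * B).
Hypotheses (eps1 : eps 1 = 1) (e_mul1 : \sum_(p <- e) p.1 * p.2 = 1).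

(** The average over B (x) B^op of a two-sided multiple of e. *)
Definition trace_elt (q : (B * B) * (B * B)) : k :=
  \sum_(p <- e) eps (q.1.1 * p.1 * q.1.2) * eps (q.2.1 * p.2 * q.2.2).

(** Plain sums already form an ideal: scaling the first entry of q scales its term. *)
Definition trace_ideal (c : k) := exists Q, c = \sum_(q <- Q) trace_elt q.

Lemma trace_idealP : ideal trace_ideal.
Proof.
split.
- by exists [::]; rewrite big_nil.
- by move=> _ _ [Q ->] [Q' ->]; exists (Q ++ Q'); rewrite big_cat.
- move=> r _ [Q ->]; exists [seq ((r *: q.1.1, q.1.2), q.2) | q <- Q].
  rewrite mulr_sumr big_map; apply: eq_bigr => q _.
  rewrite mulr_sumr; apply: eq_bigr => p _ /=.
  by rewrite -!scalerAl linearZ mulrA.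
Qed.

(** [vanishing_tensor_value] applies to e itself, modulo the radical of the ideal,
whose defining generators are exactly the values that its hypothesis requires. *)
Lemma trace_ideal1 : trace_ideal 1.
Proof.
have radT := radical_ideal_radical trace_idealP.
suff [n] : radical trace_ideal 1 by rewrite expr1n.
apply: (vanishing_tensor_value eps1 (s := e) radT).
  move=> a b b' a'; exists 1%N; rewrite expr1; exists [:: ((a, b), (b', a'))].
  rewrite big_seq1 /trace_elt mulr_sumr mulr_suml raddf_sum /=.
  by apply: eq_bigr => p _; rewrite -scalerAr -scalerAl linearZ.
move=> a b; rewrite e_mul1 scale1r subrr mulr0 mul0r linear0.
by have [[]] := radT.
Qed.

End TraceIdeal.

(** * Averaging over a separability idempotent *)

Section Averaging.
Variables (k : comPzRingType) (B : algType k) (e : seq (B * B)).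

Definition average (A : algType k) (phi : B -> A) (x : A) : A :=
  \sum_(p <- e) phi p.1 * x * phi p.2.

(** Commutation with B is required in every algebra receiving B, and not as an
equation in the tensor square of B, because average is only evaluated there. *)
Definition casimir := \sum_(p <- e) p.1 * p.2 = 1 /\
  forall (A : algType k) (phi : {lrmorphism B -> A}) x b,
    phi b * average phi x = average phi x * phi b.

Section Theory.
Variables (A : algType k) (phi : {lrmorphism B -> A}).

Lemma averageD : {morph average phi : x y / x + y}.
Proof.
move=> x y; rewrite -big_split; apply: eq_bigr => p _ /=.
by rewrite mulrDr mulrDl.
Qed.

Lemma averageZ c x : average phi (c *: x) = c *: average phi x.
Proof.
by rewrite scaler_sumr; apply: eq_bigr => p _; rewrite -scalerAr -scalerAl.
Qed.

Lemma average_sum (T : Type) (s : seq T) (F : T -> A) :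
  average phi (\sum_(j <- s) F j) = \sum_(j <- s) average phi (F j).
Proof.
apply: (big_morph _ averageD).
by rewrite /average big1 // => p _; rewrite mulr0 mul0r.
Qed.

(** With [average_image] this evaluates average on products of elements of B and
of its centraliser. *)
Lemma average_mulr x c : (forall b, phi b * c = c * phi b) ->
  average phi (x * c) = average phi x * c.
Proof.
move=> cC; rewrite mulr_suml; apply: eq_bigr => p _.
by rewrite -!mulrA cC.
Qed.

Lemma average_image b : average phi (phi b) = phi (average (@idfun B) b).
Proof. by rewrite raddf_sum; apply: eq_bigr => p _ /=; rewrite !rmorphM. Qed.

Lemma average_centraliser c : casimir -> (forall b, phi b * c = c * phi b) ->
  average phi c = c.
Proof.
move=> [e1 _] cC; rewrite -[RHS]mul1r -(rmorph1 phi) -e1 raddf_sum mulr_suml.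
by apply: eq_bigr => p _ /=; rewrite rmorphM -!mulrA cC.
Qed.

End Theory.

(** An average commutes with B, hence averages of elements of B are central.  The
faithfulness of k in B makes the scalar unique, whence the linearity of eps. *)
Lemma centre_functional : casimir -> has_center B ->
  exists eps : {scalar B}, forall b, average (@idfun B) b = (eps b)%:A.
Proof.
move=> [e1 eC] [alg_inj centre].
have /choice[eps epsE] b : exists c : k, average (@idfun B) b = c%:A.
  by apply/centre=> x; rewrite (eC B idfun).
have eps_lin : linear_for *%R eps.
  move=> c x y; apply: alg_inj; rewrite /= scalerDl -scalerA -!epsE.
  by rewrite -averageZ -averageD.
by exists (HB.pack_for {scalar B} eps
  (GRing.isLinear.Build k B k *%R eps eps_lin)).
Qed.

(** The expansion (1).  Its coefficients come from 1 being a sum of elements (2),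
so one family serves all algebras receiving B; it is used both for A and for B. *)
Lemma azumaya_expansion : casimir -> has_center B ->
  exists t : seq (B * B * B), forall (A : algType k) (phi : {lrmorphism B -> A}) x,
    x = \sum_(j <- t) phi j.1.1 * average phi (phi j.1.2 * x * phi j.2).
Proof.
move=> cas cen; have [e1 eC] := cas; have [alg_inj _] := cen.
have [eps epsE] := centre_functional cas cen.
have eps1 : eps 1 = 1.
  apply: alg_inj; rewrite /= -epsE scale1r.
  by apply: (average_centraliser (phi := idfun)) => // b; rewrite mulr1 mul1r.
have [Q Q1] := trace_ideal1 eps1 e1.
exists [seq (r.1 * q.1.1 * (q.2.2 * s.2), q.1.2 * r.2, s.1 * q.2.1)
         | q <- Q, '(r, s) <- [seq (r, s) | r <- e, s <- e]].
move=> A phi x; rewrite -[LHS]scale1r [in LHS]Q1 scaler_suml big_allpairs_dep.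
apply: eq_bigr => q _; rewrite big_allpairs_dep /= scaler_suml.
transitivity (\sum_(p <- e) \sum_(r <- e) \sum_(s <- e)
    phi (r.1 * (q.1.1 * p.1 * q.1.2) * r.2) * x
    * phi (s.1 * (q.2.1 * p.2 * q.2.2) * s.2)).
  apply: eq_bigr => p _.
  have epsx b : (eps b)%:A = phi (average idfun b) by rewrite epsE rmorph_alg.
  have -> (c d : k) : (c * d) *: x = c%:A * x * d%:A.
    by rewrite mulr_algl mulr_algr scalerA mulrC.
  rewrite !epsx /average !raddf_sum !mulr_suml; apply: eq_bigr => r _.
  by rewrite mulr_sumr.
rewrite exchange_big; apply: eq_bigr => r _ /=.
rewrite exchange_big; apply: eq_bigr => s _ /=.
(* The sum over p becomes an average once its outer factors surround it, and
   [average] lets the right one through to the left. *)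
rewrite (rmorphM phi (_ * _) (_ * _)) -mulrA eC mulrA.
rewrite mulr_sumr mulr_suml; apply: eq_bigr => p _ /=.
by rewrite !rmorphM !mulrA.
Qed.

End Averaging.

(** * Sums in bimodules and tensor products *)

Section BimoduleSums.
Variables (R S : pzRingType) (M : bimodule R S).

Lemma lact0 r : lact r (0 : M) = 0.
Proof. by apply: (addIr (lact r 0)); rewrite -lactDr !add0r. Qed.

Lemma ract0 s : ract (0 : M) s = 0.
Proof. by apply: (addIr (ract 0 s)); rewrite -ractDl !add0r. Qed.

Lemma lact_sum (J : Type) (js : seq J) r (F : J -> M) :
  lact r (\sum_(j <- js) F j) = \sum_(j <- js) lact r (F j).
Proof. by apply: (big_morph (lact r)) => [x y|]; rewrite (lactDr, lact0). Qed.

Lemma ract_sum (J : Type) (js : seq J) (F : J -> M) s :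
  ract (\sum_(j <- js) F j) s = \sum_(j <- js) ract (F j) s.
Proof. by apply: (big_morph (fun x => ract x s)) => [x y|]; rewrite (ractDl, ract0). Qed.

End BimoduleSums.

Section TensorSums.
Variables (R S T : pzRingType) (M : bimodule R S) (N : bimodule S T).

Lemma tens0l (n : N) : tens (0 : M) n = 0.
Proof. by apply: (addIr (tens (0 : M) n)); rewrite -tensDl !add0r. Qed.

Lemma tens0r (m : M) : tens m (0 : N) = 0.
Proof. by apply: (addIr (tens m (0 : N))); rewrite -tensDr !add0r. Qed.

Lemma tensNl (m : M) (n : N) : tens (- m) n = - tens m n.
Proof. by apply: (addIr (tens m n)); rewrite -tensDl !addNr tens0l. Qed.

Lemma tens_suml (J : Type) (s : seq J) (F : J -> M) (n : N) :
  tens (\sum_(j <- s) F j) n = \sum_(j <- s) tens (F j) n.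
Proof. by apply: (big_morph (fun m => tens m n)) => [x y|]; rewrite (tensDl, tens0l). Qed.

Lemma tens_sumr (J : Type) (s : seq J) (m : M) (F : J -> N) :
  tens m (\sum_(j <- s) F j) = \sum_(j <- s) tens m (F j).
Proof. by apply: (big_morph (tens m)) => [x y|]; rewrite (tensDr, tens0r). Qed.

Lemma tensor_pure_sum (t : tensor_sort M N) :
  exists s : seq (M * N), t = \sum_(p <- s) tens p.1 p.2.
Proof.
move: t; apply: tensor_ind => [|_ _ [s ->] [s' ->]|m n].
- by exists [::]; rewrite big_nil.
- exists (s ++ [seq (- p.1, p.2) | p <- s']).
  rewrite big_cat big_map -sumrN /=; congr (_ + _).
  by apply: eq_bigr => p _; rewrite tensNl.
- by exists [:: (m, n)]; rewrite big_seq1.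
Qed.

Lemma tensor_lift_sum (V : zmodType) (f : M -> N -> V) (s : seq (M * N)) :
  balanced f ->
  tensor_lift f (\sum_(p <- s) tens p.1 p.2) = \sum_(p <- s) f p.1 p.2.
Proof.
move=> fB; rewrite (big_morph _ (tensor_liftD fB) (tensor_lift0 fB)).
by apply: eq_bigr => p _; rewrite tensor_liftE.
Qed.

Lemma tensor_eq (V : zmodType) (f g : tensor_sort M N -> V) :
  {morph f : x y / x - y} -> {morph g : x y / x - y} ->
  (forall m n, f (tens m n) = g (tens m n)) -> f =1 g.
Proof.
move=> fB gB fg; apply: tensor_ind => // [|x y fx fy]; last by rewrite fB gB fx fy.
by have := fB 0 0; have := gB 0 0; rewrite !subrr => -> ->.
Qed.

End TensorSums.

(** * Split monomorphisms of bimodules *)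

Section SplitSummand.
Variables (R S : pzRingType) (M N : bimodule R S).

Section Kernel.
Variables (g : N -> M) (g_hom : bimod_hom g).

Definition hom_ker := [pred x : N | g x == 0].

Lemma hom_ker_closed : zmod_closed hom_ker.
Proof.
have [gD _ _] := g_hom.
have g0 : g 0 = 0 by apply: (addIr (g 0)); rewrite -gD !add0r.
split=> [|x y]; rewrite !inE ?g0 // => /eqP gx /eqP gy; apply/eqP.
by apply: (addIr (g y)); rewrite -gD subrK gx gy addr0.
Qed.

HB.instance Definition _ := GRing.isZmodClosed.Build N hom_ker hom_ker_closed.

Definition kernel := {x : N | hom_ker x}.

HB.instance Definition _ := SubChoice.on kernel.
HB.instance Definition _ := [SubChoice_isSubZmodule of kernel by <:].

Lemma hom_ker_lact r (x : kernel) : hom_ker (lact r (val x)).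
Proof.
by have [_ gl _] := g_hom; rewrite inE gl (eqP (valP x)) lact0.
Qed.

Lemma hom_ker_ract s (x : kernel) : hom_ker (ract (val x) s).
Proof.
by have [_ _ gr] := g_hom; rewrite inE gr (eqP (valP x)) ract0.
Qed.

Definition kernel_lact r (x : kernel) : kernel := Sub _ (hom_ker_lact r x).
Definition kernel_ract (x : kernel) s : kernel := Sub _ (hom_ker_ract s x).

Definition kernel_bimod : bimodule R S.
Proof.
apply: (@Bimodule R S kernel kernel_lact kernel_ract) => *; apply: val_inj => /=.
- exact: lactDr.
- exact: lactDl.
- exact: lactA.
- exact: lact1.
- exact: ractDl.
- exact: ractDr.
- exact: ractA.
- exact: ract1.
- exact: lract.
Defined.

End Kernel.

(** The complement of the image of f is the kernel of g, onto which id - f g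
projects. *)
Lemma split_summand (f : M -> N) (g : N -> M) :
  bimod_hom f -> bimod_hom g -> cancel f g -> isom_to_summand M N.
Proof.
move=> f_hom g_hom fK; have [[fD fl fr] [gD gl gr]] := (f_hom, g_hom).
exists (kernel_bimod g_hom); pose K := kernel g.
exists (fun x : bimod_sum M (kernel_bimod g_hom) => f x.1 + val (x.2 : K)).
  split=> [x y|r x|x s] /=.
  - by rewrite fD addrACA.
  - by rewrite lactDr fl.
  - by rewrite ractDl fr.
have gB x y : g (x - y) = g x - g y by apply/eqP; rewrite eq_sym subr_eq -gD subrK.
have ker_proj x : hom_ker g (x - f (g x)) by rewrite inE gB fK subrr.
exists (fun x => (g x, (Sub _ (ker_proj x) : K))) => [[x y]|x] /=; last first.
  by rewrite addrC subrK.
have gxy : g (f x + val (y : K)) = x by rewrite gD fK (eqP (valP (y : K))) addr0.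
apply: injective_projections => //=; apply: val_inj => /=.
by rewrite gxy addrC addKr.
Qed.

End SplitSummand.

(** * Centrally projective extensions have depth two *)

Section CentrallyProjective.
Variables (B A : pzRingType) (i : {rmorphism B -> A}).

(** A is a direct summand of the n-th power of B as a B-bimodule: a bimodule map
from B to A amounts to an element of A commuting with the image of B. *)
Definition centrally_projective n := exists (c : 'I_n -> A) (b : 'I_n -> A -> B),
  [/\ forall l x, i x * c l = c l * i x,
      forall l x y, b l (x + y) = b l x + b l y,
      forall l x y, b l (i x * y) = x * b l y,
      forall l x y, b l (y * i x) = b l y * x &
      forall x, x = \sum_(l < n) i (b l x) * c l].

(** The maps from the tensor square to A and back are x (x) y |-> b_l(x) y and
y |-> c_l (x) y; the second is left B-linear as c_l commutes with B. *)
Lemma left_depth_two_centrally_projective n :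
  (0 < n)%N -> centrally_projective n -> left_depth_two i.
Proof.
move=> n_gt0 [c [b [cC bD bl br bE]]]; exists n => //.
pose h l (x : ring_bimod i i) (y : ring_bimod i (@idfun A)) : A :=
  i (b l (x : A)) * (y : A).
have h_bal l : balanced (h l).
  split=> [x x' y|x y y'|x s y]; rewrite /h /=.
  - by rewrite bD rmorphD mulrDl.
  - by rewrite mulrDr.
  - by rewrite br rmorphM mulrA.
have hB l := tensor_liftB (h_bal l).
pose f (t : tensor_sq_BA i) : bimod_pow (ring_bimod i (@idfun A)) n :=
  [ffun l => tensor_lift (h l) t].
pose g (x : bimod_pow (ring_bimod i (@idfun A)) n) : tensor_sq_BA i :=
  \sum_(l < n) tens (c l : ring_bimod i i) (x l).
have fD : {morph f : x y / x + y}.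
  by move=> x y; apply/ffunP=> l; rewrite !ffunE (tensor_liftD (h_bal l)).
have gD : {morph g : x y / x + y}.
  by move=> x y; rewrite -big_split; apply: eq_bigr => l _; rewrite ffunE tensDr.
apply: (split_summand (f := f) (g := g)).
- split=> // [r x|x s]; apply/ffunP=> l; rewrite !ffunE.
    move: x; apply: tensor_eq => [x y|x y|x y].
    + by rewrite /= tensor_lactB hB.
    + by rewrite /= hB mulrBr.
    + by rewrite /= tensor_lactE !(tensor_liftE (h_bal l)) /h /= bl rmorphM mulrA.
  move: x; apply: tensor_eq => [x y|x y|x y].
  + by rewrite /= tensor_ractB hB.
  + by rewrite /= hB mulrBl.
  + by rewrite /= tensor_ractE !(tensor_liftE (h_bal l)) /h /= mulrA.
- split=> // [r x|x s]; rewrite /g (lact_sum, ract_sum); apply: eq_bigr => l _.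
    by rewrite ffunE /= tensor_lactE /= cC -tensM.
  by rewrite ffunE /= tensor_ractE.
- apply: tensor_eq => [x y|//|x y].
    by apply/eqP; rewrite eq_sym subr_eq -gD -fD subrK.
  rewrite [in RHS](bE (x : A)) tens_suml; apply: eq_bigr => l _.
  by rewrite ffunE (tensor_liftE (h_bal l)) cC -tensM.
Qed.

(** Mirror image, with x (x) y |-> x b_l(y) and x |-> x (x) c_l. *)
Lemma right_depth_two_centrally_projective n :
  (0 < n)%N -> centrally_projective n -> right_depth_two i.
Proof.
move=> n_gt0 [c [b [cC bD bl br bE]]]; exists n => //.
pose h l (x : ring_bimod (@idfun A) i) (y : ring_bimod i i) : A :=
  (x : A) * i (b l (y : A)).
have h_bal l : balanced (h l).
  split=> [x x' y|x y y'|x s y]; rewrite /h /=.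
  - by rewrite mulrDl.
  - by rewrite bD rmorphD mulrDr.
  - by rewrite bl rmorphM mulrA.
have hB l := tensor_liftB (h_bal l).
pose f (t : tensor_sq_AB i) : bimod_pow (ring_bimod (@idfun A) i) n :=
  [ffun l => tensor_lift (h l) t].
pose g (x : bimod_pow (ring_bimod (@idfun A) i) n) : tensor_sq_AB i :=
  \sum_(l < n) tens (x l) (c l : ring_bimod i i).
have fD : {morph f : x y / x + y}.
  by move=> x y; apply/ffunP=> l; rewrite !ffunE (tensor_liftD (h_bal l)).
have gD : {morph g : x y / x + y}.
  by move=> x y; rewrite -big_split; apply: eq_bigr => l _; rewrite ffunE tensDl.
apply: (split_summand (f := f) (g := g)).
- split=> // [r x|x s]; apply/ffunP=> l; rewrite !ffunE.
    move: x; apply: tensor_eq => [x y|x y|x y].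
    + by rewrite /= tensor_lactB hB.
    + by rewrite /= hB mulrBr.
    + by rewrite /= tensor_lactE !(tensor_liftE (h_bal l)) /h /= mulrA.
  move: x; apply: tensor_eq => [x y|x y|x y].
  + by rewrite /= tensor_ractB hB.
  + by rewrite /= hB mulrBl.
  + by rewrite /= tensor_ractE !(tensor_liftE (h_bal l)) /h /= br rmorphM mulrA.
- split=> // [r x|x s]; rewrite /g (lact_sum, ract_sum); apply: eq_bigr => l _.
    by rewrite ffunE /= tensor_lactE.
  by rewrite ffunE /= tensor_ractE /= -cC tensM.
- apply: tensor_eq => [x y|//|x y].
    by apply/eqP; rewrite eq_sym subr_eq -gD -fD subrK.
  rewrite [in RHS](bE (y : A)) tens_sumr; apply: eq_bigr => l _.
  by rewrite ffunE (tensor_liftE (h_bal l)) tensM.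
Qed.

End CentrallyProjective.

(** * Azumaya algebras *)

Section CasimirOfSeparable.
Variables (k : comPzRingType) (B : algType k).

Let M := ring_bimod (@idfun B) (GRing.in_alg B).
Let N := ring_bimod (GRing.in_alg B) (@idfun B).

(** Scalars are central in A, so averaging is defined on the tensor square of B
over k; this transports the commutation of the separability idempotent with B to A. *)
Lemma sandwich_balanced (A : algType k) (phi : {lrmorphism B -> A}) (x : A) :
  balanced (fun (u : M) (v : N) => phi (u : B) * x * phi (v : B)).
Proof.
split=> [u u' v|u v v'|u c v] /=.
- by rewrite rmorphD !mulrDl.
- by rewrite rmorphD mulrDr.
- by rewrite mulr_algr mulr_algl !linearZ /= -scalerAr -!scalerAl.
Qed.

(** The terms of s(1), for s a bimodule section of the multiplication. *)
Lemma casimir_of_separable : separable_algebra B -> exists e : seq (B * B), casimir e.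
Proof.
case=> s [sD sl sr] sK.
have [e eE] := tensor_pure_sum (s (1 : B)).
exists e; split=> [|A phi x b].
  have mul_bal : balanced (fun (u : M) (v : N) => (u : B) * (v : B)).
    by split=> [u u' v|u v v'|u c v] /=; rewrite (mulrDl, mulrDr, mulrA).
  by rewrite -[RHS](sK (1 : B)) eE [RHS](tensor_lift_sum e mul_bal).
have bal := sandwich_balanced phi x.
pose L : tensor M N -> A :=
  tensor_lift (fun (u : M) (v : N) => phi (u : B) * x * phi (v : B)).
have LB : {morph L : x y / x - y} by apply: tensor_liftB.
have -> : average e phi x = L (s (1 : B)) by rewrite eE [RHS](tensor_lift_sum e bal).
have Ll : forall t, phi b * L t = L (tensor_lact b t).
  apply: tensor_eq => [y z|y z|y z].
  - by rewrite LB mulrBr.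
  - by rewrite tensor_lactB LB.
  - by rewrite tensor_lactE /L !(tensor_liftE bal) /= rmorphM !mulrA.
have Lr : forall t, L t * phi b = L (tensor_ract t b).
  apply: tensor_eq => [y z|y z|y z].
  - by rewrite LB mulrBl.
  - by rewrite tensor_ractB LB.
  - by rewrite tensor_ractE /L !(tensor_liftE bal) /= rmorphM !mulrA.
rewrite Ll Lr; congr (L _).
by have := sl b (1 : B); have := sr (1 : B) b; rewrite /= mulr1 mul1r => <-.
Qed.

End CasimirOfSeparable.

(** A splits off the free module on its generators; the forms f are the
coordinates of a splitting. *)
Lemma dual_basis (k : comPzRingType) (V : lmodType k) :
  finitely_generated V -> projective V ->
  exists n (v : 'I_n -> V) (f : 'I_n -> {scalar V}),
    forall x, x = \sum_(l < n) f l x *: v l.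
Proof.
move=> [n [v v_gen]] proj.
pose p (c : {ffun 'I_n -> k^o}) : V := \sum_(l < n) c l *: v l.
have p_lin : linear p.
  move=> a c d; rewrite /p scaler_sumr -big_split; apply: eq_bigr => l _.
  by rewrite !ffunE scalerDl scalerA.
pose P : {linear {ffun 'I_n -> k^o} -> V} :=
  HB.pack p (GRing.isLinear.Build _ _ _ _ p p_lin).
have [|g gK] := proj _ _ P idfun.
  move=> x; have [c ->] := v_gen x; exists [ffun l => c l].
  by apply: eq_bigr => l _; rewrite ffunE.
pose f l (x : V) : k := g x l.
have f_lin l : linear_for *%R (f l).
  by move=> a x y; rewrite /f linearP !ffunE.
exists n, v, (fun l => HB.pack_for {scalar V} (f l)
  (GRing.isLinear.Build k V k *%R (f l) (f_lin l))).
by move=> x; rewrite -[LHS](gK x).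
Qed.

(** The bimodule maps b_l are sum f_l(E(y x z)) w in the notation of (1), and send
w E(x) to f_l(E(x)) w. *)
Lemma azumaya_centrally_projective (k : comPzRingType) (B A : algType k)
    (i : {lrmorphism B -> A}) n (v : 'I_n -> A) (f : 'I_n -> {scalar A}) :
  Azumaya B -> (forall x, x = \sum_(l < n) f l x *: v l) -> centrally_projective i n.
Proof.
move=> [sepB cenB] vE; have [e cas] := casimir_of_separable sepB.
have [e1 eC] := cas; have [t tE] := azumaya_expansion cas cenB.
have [eps epsE] := centre_functional cas cenB.
pose E := average e i.
pose b l x : B := \sum_(j <- t) f l (E (i j.1.2 * x * i j.2)) *: j.1.1.
have bD l : {morph b l : x y / x + y}.
  move=> x y; rewrite -big_split; apply: eq_bigr => j _ /=.
  by rewrite mulrDr mulrDl /E averageD linearD scalerDl.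
have b_sum l (F : B * B * B -> A) :
    b l (\sum_(j <- t) F j) = \sum_(j <- t) b l (F j).
  apply: (big_morph _ (bD l)).
  by apply: (addIr (b l 0)); rewrite -bD !add0r.
have bE l w x : b l (i w * E x) = f l (E x) *: w.
  rewrite [in RHS](tE B idfun w) scaler_sumr; apply: eq_bigr => j _ /=.
  (* E x leaves the average on the right, and what remains is the scalar
     eps(y w z); summing against (1) for B restores w. *)
  have -> : E (i j.1.2 * (i w * E x) * i j.2) = eps (j.1.2 * w * j.2) *: E x.
    rewrite -!mulrA -eC !mulrA -!rmorphM /E average_mulr; last by move=> y; apply: eC.
    by rewrite average_image epsE rmorph_alg mulr_algl.
  by rewrite linearZ /= epsE mulr_algr scalerA mulrC.
exists (fun l => E (v l)), b; split=> //.
- by move=> l x; apply: eC.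
- move=> l x y; rewrite (tE A i y) mulr_sumr !b_sum mulr_sumr; apply: eq_bigr => j _.
  by rewrite mulrA -rmorphM !bE scalerAr.
- move=> l x y; rewrite (tE A i y) mulr_suml !b_sum mulr_suml; apply: eq_bigr => j _.
  by rewrite -[_ * _ * i x]mulrA -eC mulrA -rmorphM !bE scalerAl.
move=> x; rewrite {1}(tE A i x).
under [RHS]eq_bigr do rewrite raddf_sum mulr_suml.
rewrite exchange_big; apply: eq_bigr => j _ /=.
set c := average e i (_ * _ * _); have cC y : i y * c = c * i y by apply: eC.
(* The dual basis of A, averaged, is a dual basis of the centraliser. *)
rewrite -[in LHS](average_centraliser cas cC) [in LHS](vE c) average_sum mulr_sumr.
apply: eq_bigr => l _.
by rewrite averageZ linearZ /= -scalerAr -scalerAl.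
Qed.

Theorem theorem2p3 (k : comPzRingType) (B A : algType k)
  (i : {lrmorphism B -> A}) (i_inj : injective i)
  (B_Azumaya : Azumaya B)
  (A_fg : finitely_generated A) (A_proj : projective A) :
  depth_two i.
Proof.
have [n [v [f vE]]] := dual_basis A_fg A_proj.
have n_gt0 : (0 < n)%N.
  case: n v f vE => // v f /(_ 1).
  by rewrite big_ord0 => /eqP; rewrite oner_eq0.
have iP := azumaya_centrally_projective i B_Azumaya vE.
split; first exact: left_depth_two_centrally_projective iP.
exact: right_depth_two_centrally_projective iP.
Qed.
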